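(* Let $(\widetilde\pi,\widetilde K)$ be a finite-rank base pair with Stein feature vector $\widetilde F$, and let $(\pi_H,K_H)$ be the conjugate pair constructed from a $C^2$ orientation-preserving diffeomorphism $H:\mathbb R^d\to\mathbb R^d$ as in the context, with Stein feature vector $F_H$. Fix an initial law $\widetilde\mu_0$ and set $\mu_0^H:=H_\#\widetilde\mu_0$. Let $(\widetilde\mu_t)_{t\ge0}$ be the base mean-field solution started from $\widetilde\mu_0$ and $(\mu_t^H)_{t\ge0}$ the transformed mean-field solution started from $\mu_0^H$. Let $\widetilde X_1(0),\dots,\widetilde X_N(0)$ be i.i.d. with law $\widetilde\mu_0$ and set $X_i^H(0):=H(\widetilde X_i(0))$, $i=1,\dots,N$. Let $\widetilde\mu_t^N$ and $\mu_t^{H,N}$ be the corresponding empirical measures of the base and transformed $N$-particle systems. Then, for every $t\ge0$, $$d_{F_H}(\mu_t^{H,N},\mu_t^H)=d_{\widetilde F}(\widetilde\mu_t^N,\widetilde\mu_t).$$ Consequently, any propagation-of-chaos estimate for the base pair in the restricted feature metric transfers to every conjugate pair with the same rate and the same constant. In particular, if for some rate $\varepsilon_N\to0$ one has $\mathbb E\big[\sup_{t\ge0}d_{\widetilde F}^2(\widetilde\mu_t^N,\widetilde\mu_t)\big]\le C\varepsilon_N$, then $$\mathbb E\Big[\sup_{t\ge0}d_{F_H}^2(\mu_t^{H,N},\mu_t^H)\Big]\le C\varepsilon_N.$$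
   Context: **Matrix-kernel SVGD.** For $\pi\propto e^{-V}$ on $\mathbb R^d$ and a finite-rank matrix kernel $K(x,y)=B(x)B(y)^\top$, $B(x)\in\mathbb R^{d\times m}$ with columns $b_1,\dots,b_m$, the Stein features are $f_j:=\mathrm{div}\,b_j-b_j\cdot\nabla V$, $F=(f_1,\dots,f_m)$, and $\rho F:=\int F\,d\rho$. The velocity is $v_\rho(x):=\int\{-K(x,y)\nabla V(y)+\mathrm{div}_yK(x,y)\}\rho(dy)=B(x)\,\rho F$, with $[\mathrm{div}_yK]_a=\sum_b\partial_{y_b}K_{ab}$. Mean-field equation: $\partial_t\mu_t+\nabla\cdot(v_{\mu_t}\mu_t)=0$ (weak sense). Particle system: $\dot X_i(t)=v_{\mu_t^N}(X_i(t))$, $\mu_t^N=\frac1N\sum_i\delta_{X_i(t)}$. Feature metric: $d_F(\rho,\nu):=\|\rho F-\nu F\|_2$. Standing assumption: only kernels and initial laws for which the particle system and the mean-field equation are globally well-posed (with the feature expectations finite) are considered. **Conjugate pair.** Base target $\widetilde\pi(dy)=\widetilde Z^{-1}e^{-\widetilde V(y)}dy$ and base kernel $\widetilde K(y,y')=\widetilde B(y)\widetilde B(y')^\top$. With $J:=DH$, define $V_H(H(y)):=\widetilde V(y)+\log\det J(y)$, $\pi_H:=H_\#\widetilde\pi\propto e^{-V_H}$, $B_H(H(y)):=J(y)\widetilde B(y)$ and $K_H(H(y),H(y')):=J(y)\widetilde K(y,y')J(y')^\top$, i.e. $K_H(x,x')=B_H(x)B_H(x')^\top$. $\widetilde F$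 is the Stein feature vector computed from $(\widetilde V,\widetilde B)$, $F_H$ that computed from $(V_H,B_H)$. *)

(* Defs.v *)
(* Points of R^d are row vectors 'rV[R]_d, equipped with the
   sigma-algebra generated by the open sets. *)
From HB Require Import structures.
From mathcomp Require Import all_boot all_order all_algebra.
From mathcomp Require Import all_classical all_reals all_analysis.

Set Implicit Arguments.
Unset Strict Implicit.
Unset Printing Implicit Defensive.

Import Order.TTheory GRing.Theory Num.Theory.
Import numFieldNormedType.Exports.

Local Open Scope classical_set_scope.
Local Open Scope ring_scope.

Notation borel_rV R d := (g_sigma_algebraType (@open 'rV[R]_d)).

Section Calculus.
Context (R : realType).

Definition partial (d : nat) (i : 'I_d) (f : 'rV[R]_d -> R) (x : 'rV[R]_d) : R :=
  'D_(delta_mx 0 i) f x.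

Definition C1 (d : nat) (f : 'rV[R]_d -> R) : Prop :=
  (forall x, differentiable f x) /\ (forall i, continuous (partial i f)).

Definition C2 (d : nat) (f : 'rV[R]_d -> R) : Prop :=
  C1 f /\ (forall i, C1 (partial i f)).

(* The library's jacobian acts on row vectors from the right, so that
   (DH H y) a b = d H_a / d y_b requires a transposition. *)
Definition DH (d : nat) (H : 'rV[R]_d -> 'rV[R]_d) (y : 'rV[R]_d) : 'M[R]_d :=
  (jacobian H y)^T.

Definition C2_diffeo (d : nat) (H Hinv : 'rV[R]_d -> 'rV[R]_d) : Prop :=
  [/\ cancel H Hinv, cancel Hinv H,
      (forall a, C2 (fun y => H y 0 a)) & (forall a, C2 (fun x => Hinv x 0 a))].

Definition orientation_preserving (d : nat) (H : 'rV[R]_d -> 'rV[R]_d) : Prop :=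
  forall y, 0 < \det (DH H y).

Definition C1_compactly_supported (d : nat) (phi : 'rV[R]_d -> R) : Prop :=
  C1 phi /\ exists2 S : set 'rV[R]_d, compact S & forall x, ~ S x -> phi x = 0.

End Calculus.

Section Measures.
Context (R : realType).

(* Lebesgue measure on R^d, by slicing (Cavalieri): the measure of A is the
   integral over the first coordinate of the measure of its sections. *)
Fixpoint lebesgue_rV (d : nat) : set 'rV[R]_d -> \bar R :=
  match d return set 'rV[R]_d -> \bar R with
  | 0%N => fun A => (\1_A 0)%:E
  | d'.+1 => fun A =>
      (\int[@lebesgue_measure R]_x
         lebesgue_rV [set y : 'rV[R]_d' | A (row_mx (const_mx x : 'rV[R]_1) y)])%E
  end.

Definition gibbs (d : nat) (V : 'rV[R]_d -> R)
    (pi : set (borel_rV R d) -> \bar R) : Prop :=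
  exists2 Z : R, 0 < Z & forall A : set (borel_rV R d), measurable A ->
    pi A = (Z^-1%:E *
      integral (@lebesgue_rV d : set (borel_rV R d) -> \bar R) A
        (fun x => (expR (- V x))%:E))%E.

Definition push (d : nat) (H : 'rV[R]_d -> 'rV[R]_d)
    (mu : set (borel_rV R d) -> \bar R) : set (borel_rV R d) -> \bar R :=
  pushforward mu (H : borel_rV R d -> borel_rV R d).

Definition empirical (d N : nat) (X : 'I_N -> 'rV[R]_d)
    (A : set (borel_rV R d)) : \bar R :=
  ((N%:R^-1)%:E * \sum_(i < N) \d_(X i : borel_rV R d) A)%E.

Section empirical_measure.
Context (d N : nat) (X : 'I_N -> 'rV[R]_d).

Let m (k : nat) : {measure set (borel_rV R d) -> \bar R} :=
  if insub k is Some i then \d_(X i : borel_rV R d) else mzero.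

Let empiricalE : empirical X = mscale (N%:R^-1)%:nng (msum m N).
Proof.
apply/funext => A; rewrite /empirical /mscale /msum /=; congr (_ * _)%E.
by apply: eq_bigr => i _; rewrite /m valK.
Qed.

Let empirical0 : empirical X set0 = 0%E.
Proof. by rewrite empiricalE measure0. Qed.

Let empirical_ge0 A : (0 <= empirical X A)%E.
Proof. by rewrite empiricalE measure_ge0. Qed.

Let empirical_sigma_additive : semi_sigma_additive (empirical X).
Proof. by rewrite empiricalE; exact: measure_semi_sigma_additive. Qed.

HB.instance Definition _ := isMeasure.Build _ (borel_rV R d) R (empirical X)
  empirical0 empirical_ge0 empirical_sigma_additive.

End empirical_measure.

Definition iid (dO : measure_display) (Om : measurableType dO)
    (P : probability Om R) (d N : nat) (mu : set (borel_rV R d) -> \bar R)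
    (X : 'I_N -> Om -> borel_rV R d) : Prop :=
  [/\ (forall i, measurable_fun setT (X i)),
      (forall i A, measurable A -> P (X i @^-1` A) = mu A) &
      (forall (J : {set 'I_N}) (A : 'I_N -> set (borel_rV R d)),
         (forall i, measurable (A i)) ->
         P (\bigcap_(i in [set` J]) X i @^-1` A i) =
         (\prod_(i in J) P (X i @^-1` A i))%E)].

End Measures.

Section SVGD.
Context (R : realType) (d m : nat).
Implicit Types (V : 'rV[R]_d -> R) (B : 'rV[R]_d -> 'M[R]_(d, m)).
Implicit Types (rho nu : {measure set (borel_rV R d) -> \bar R}).

Definition kernel B (x y : 'rV[R]_d) : 'M[R]_d := B x *m (B y)^T.

(* f_j = div b_j - b_j . grad V, where b_j is the j-th column of B *)
Definition stein_feature V B (x : 'rV[R]_d) : 'rV[R]_m :=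
  \row_j (\sum_a partial a (fun y => B y a j) x
          - \sum_a B x a j * partial a V x).

Definition feature_mean V B rho : 'rV[R]_m :=
  \row_j \int[rho]_x stein_feature V B x 0 j.

Definition feature_dist V B rho nu : R :=
  Num.sqrt (\sum_j ((feature_mean V B rho - feature_mean V B nu) 0 j) ^+ 2).

(* v_rho(x) = int { - K(x,y) grad V(y) + div_y K(x,y) } rho(dy) *)
Definition velocity V B rho (x : 'rV[R]_d) : 'rV[R]_d :=
  \row_a \int[rho]_y
    (- (\sum_b kernel B x y a b * partial b V y)
     + \sum_b partial b (fun z => kernel B x z a b) y).

Definition particle_solution V B (N : nat) (x0 : 'I_N -> 'rV[R]_d)
    (X : R -> 'I_N -> 'rV[R]_d) : Prop :=
  [/\ (forall i, X 0 i = x0 i),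
      (forall i, {within `[0, +oo[%classic, continuous (fun t => X t i)}) &
      (forall (t : R) i, 0 < t ->
         is_derive t 1 (fun s => X s i) (velocity V B (empirical (X t)) (X t i)))].

Definition particle_well_posed V B (N : nat) (x0 : 'I_N -> 'rV[R]_d) : Prop :=
  (exists X, particle_solution V B x0 X) /\
  (forall X Y, particle_solution V B x0 X -> particle_solution V B x0 Y ->
     forall t, 0 <= t -> forall i, X t i = Y t i).

(* Weak solutions on [0, +oo[ of d_t mu_t + div (v_{mu_t} mu_t) = 0, with finite
   feature expectations.  The weak form is integrated in time, against C^1
   compactly supported test functions; only times t >= 0 are constrained. *)
Definition mean_field_solution V B (mu0 : set (borel_rV R d) -> \bar R)
    (mu : R -> probability (borel_rV R d) R) : Prop :=
  [/\ (forall A, measurable A -> mu 0 A = mu0 A),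
      (forall t j, 0 <= t ->
         (mu t).-integrable setT (fun x => (stein_feature V B x 0 j)%:E)) &
      (forall phi, C1_compactly_supported phi ->
         let rate s :=
           \int[mu s]_x (\sum_a partial a phi x * velocity V B (mu s) x 0 a) in
         forall t, 0 <= t ->
           (@lebesgue_measure R).-integrable `[0, t] (fun s => (rate s)%:E) /\
           \int[mu t]_x phi x =
             \int[mu 0]_x phi x
             + \int[@lebesgue_measure R]_(s in `[0, t]) rate s)].

Definition mean_field_well_posed V B (mu0 : set (borel_rV R d) -> \bar R) : Prop :=
  (exists mu, mean_field_solution V B mu0 mu) /\
  (forall mu1 mu2, mean_field_solution V B mu0 mu1 ->
     mean_field_solution V B mu0 mu2 ->
     forall t, 0 <= t -> forall A, measurable A -> mu1 t A = mu2 t A).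

(* Potential and kernel factor of the conjugate pair: V_H and B_H are given at
   x = H y, that is y = Hinv x. *)
Definition conj_potential V (H Hinv : 'rV[R]_d -> 'rV[R]_d) (x : 'rV[R]_d) : R :=
  V (Hinv x) + ln (\det (DH H (Hinv x))).

Definition conj_factor B (H Hinv : 'rV[R]_d -> 'rV[R]_d) (x : 'rV[R]_d) :
  'M[R]_(d, m) := DH H (Hinv x) *m B (Hinv x).

End SVGD.

(* Main.v *)
(* The Stein features are transported by the change of variables: F_H (H y) =
   F y.  Indeed div b_j and b_j . grad V change under H by the same term
   b_j . grad log det DH, by Jacobi's formula and the symmetry of the second
   derivatives of H.  Hence H pushes a measure rho to a measure with the same
   feature mean, and since v_rho (x) = B x (rho F), the velocity field of the
   conjugate pair is the push-forward by DH of the base one.  So H maps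
   particle solutions to particle solutions and mean-field solutions to
   mean-field solutions, and uniqueness identifies these images with the
   solutions of the transformed systems: both feature means in the error are
   unchanged. *)
Require Import Defs.
From HB Require Import structures.
From mathcomp Require Import all_boot all_order all_algebra perm.
From mathcomp Require Import all_classical all_reals all_analysis measurable_realfun.

Set Implicit Arguments.
Unset Strict Implicit.
Unset Printing Implicit Defensive.

Import Order.TTheory GRing.Theory Num.Theory.
Import numFieldNormedType.Exports.

Local Open Scope classical_set_scope.
Local Open Scope ring_scope.

(** * Coordinatewise differentiation and the chain rule in partial derivatives *)

Lemma differentiable_mxP (R : realType) (V : normedModType R) (m n : nat)
    (M : V -> 'M[R]_(m, n)) (x : V) :
  differentiable M x <-> forall i j, differentiable (fun y => M y i j) x.
Proof.
split=> [dM i j|dM].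
  exact: (differentiable_comp dM (differentiable_coord (M x) i j)).
have -> : M = \sum_i \sum_j (fun y => M y i j *: delta_mx i j).
  apply/funext => y; rewrite [LHS]matrix_sum_delta fct_sumE.
  by apply: eq_bigr => i _; rewrite fct_sumE.
do 2![apply: differentiable_sum => ?]; exact: differentiableZl.
Qed.

Lemma differentiable_fsum (R : realType) (V W : normedModType R) (n : nat)
    (f : 'I_n -> V -> W) (x : V) :
  (forall i, differentiable (f i) x) ->
  differentiable (fun y => \sum_i f i y) x.
Proof.
have -> : (fun y => \sum_i f i y) = \sum_i f i by apply/funext => y; rewrite fct_sumE.
exact: differentiable_sum.
Qed.

Lemma derive_fsum (R : realType) (V W : normedModType R) (n : nat)
    (f : 'I_n -> V -> W) (x v : V) :
  (forall i, derivable (f i) x v) ->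
  'D_v (fun y => \sum_i f i y) x = \sum_i 'D_v (f i) x.
Proof.
have -> : (fun y => \sum_i f i y) = \sum_i f i by apply/funext => y; rewrite fct_sumE.
exact: derive_sum.
Qed.

Lemma diff_partialE (R : realType) (d : nat) (W : normedModType R)
    (f : 'rV[R]_d -> W) (x v : 'rV[R]_d) :
  differentiable f x -> 'd f x v = \sum_i v 0 i *: 'D_(delta_mx 0 i) f x.
Proof.
move=> df; rewrite {1}[v]row_sum_delta linear_sum.
by apply: eq_bigr => i _; rewrite linearZ /= deriveE.
Qed.

Lemma derive_coord (R : realType) (V : normedModType R) (m n : nat)
    (M : V -> 'M[R]_(m, n)) (x v : V) i j :
  differentiable M x -> 'D_v (fun y => M y i j) x = ('D_v M x) i j.
Proof. by move=> dM; rewrite derive_mx ?mxE//; exact: diff_derivable. Qed.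

Lemma derive_comp_partial (R : realType) (V : normedModType R) (d : nat)
    (f : 'rV[R]_d -> R) (H : V -> 'rV[R]_d) (y v : V) :
  differentiable H y -> differentiable f (H y) ->
  'D_v (f \o H) y = \sum_a 'D_v (fun z => H z 0 a) y * partial a f (H y).
Proof.
move=> dH df; rewrite deriveE; last exact: differentiable_comp.
rewrite diff_comp //= -(deriveE v dH) diff_partialE //.
by apply: eq_bigr => a _; rewrite derive_coord.
Qed.

Lemma DHE (R : realType) (d : nat) (H : 'rV[R]_d -> 'rV[R]_d) y a b :
  differentiable H y -> DH H y a b = partial b (fun z => H z 0 a) y.
Proof. by move=> dH; rewrite /partial derive_coord // deriveE // !mxE. Qed.

(** The difference quotient of [f] along the line at parameter [s] is the one defining ['D_v f] at
    the point [s *: v + p]. This reduces directional derivatives to one variable, where the mean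
    value theorem applies. *)
Lemma is_derive_line (R : realType) (V W : normedModType R) (f : V -> W)
    (p v : V) (s : R) : differentiable f (s *: v + p) ->
  is_derive s 1 (fun r => f (r *: v + p)) ('D_v f (s *: v + p)).
Proof.
move=> df; apply: DeriveDef.
  apply/derivable1_diffP.
  have dl : differentiable (fun r : R => r *: v + p) s.
    have -> : (fun r : R => r *: v + p) = ( *:%R ^~ v) + cst p by [].
    by apply: differentiableD.
  exact: (differentiable_comp dl df).
rewrite /derive; set g := (fun h => _); set g' := (fun h => _ : W).
suff -> : g = g' by []; apply/funext => h; rewrite /g /g' /=.
by rewrite scalerDl addrA [h%:A]mulr1.
Qed.

(** * Derivatives of finite products and of determinants *)

Lemma differentiable_fprod (R : realType) (V : normedModType R) (n : nat)
    (f : 'I_n -> V -> R) (x : V) :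
  (forall i, differentiable (f i) x) ->
  differentiable (fun y => \prod_i f i y) x.
Proof.
elim: n f => [|n IH] f df.
  by under eq_fun do rewrite big_ord0; exact: differentiable_cst.
under eq_fun do rewrite big_ord_recl.
by apply: differentiableM => //; exact: IH.
Qed.

Lemma derive_fprod (R : realType) (V : normedModType R) (n : nat)
    (f : 'I_n -> V -> R) (x v : V) :
  (forall i, differentiable (f i) x) ->
  'D_v (fun y => \prod_i f i y) x =
  \sum_k 'D_v (f k) x * \prod_(i | i != k) f i x.
Proof.
elim: n f => [|n IH] f df.
  by under eq_fun do rewrite big_ord0; rewrite derive_cst big_ord0.
under eq_fun do rewrite big_ord_recl.
rewrite deriveM; [|exact: diff_derivable|]; last first.
  by apply: diff_derivable; exact: differentiable_fprod.
rewrite IH // big_ord_recl addrC; congr (_ + _).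
  rewrite mulrC [in RHS]big_mkcond big_ord_recl /= mul1r.
  by congr (_ * _); apply: eq_bigr.
rewrite /GRing.scale /= mulr_sumr; apply: eq_bigr => k _.
rewrite [in RHS]big_mkcond big_ord_recl /= mulrCA; congr (_ * (_ * _)).
by rewrite [in LHS]big_mkcond; apply: eq_bigr.
Qed.

Lemma differentiable_det (R : realType) (V : normedModType R) (n : nat)
    (M : V -> 'M[R]_n) (x : V) :
  differentiable M x -> differentiable (fun y => \det (M y)) x.
Proof.
move=> /differentiable_mxP dM; rewrite /determinant.
have -> : (fun y => \sum_(s : 'S_n) (-1) ^+ s * \prod_i M y i (s i)) =
    \sum_(s : 'S_n) (fun y => (-1) ^+ s * \prod_i M y i (s i)).
  by apply/funext => y; rewrite fct_sumE.
elim/big_ind : _ => [|g h dg dh|s _]; first exact: differentiable_cst.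
  exact: differentiableD.
by apply: differentiableM => //; exact: differentiable_fprod.
Qed.

(* Leibniz' formula makes the derivative of the determinant the sum over k of
   the determinants with the k-th row differentiated; expand along that row. *)
Lemma derive_det (R : realType) (V : normedModType R) (n : nat)
    (M : V -> 'M[R]_n) (x v : V) : differentiable M x ->
  'D_v (fun y => \det (M y)) x =
  \sum_i \sum_j 'D_v (fun y => M y i j) x * cofactor (M x) i j.
Proof.
move=> /differentiable_mxP dM.
pose N k : 'M[R]_n := \matrix_(i, j) (if i == k then 'D_v (fun y => M y i j) x else M x i j).
transitivity (\sum_k \det (N k)).
  rewrite /determinant.
  have -> : (fun y => \sum_(s : 'S_n) (-1) ^+ s * \prod_i M y i (s i)) =
      \sum_(s <- index_enum 'S_n) (fun y => (-1) ^+ s * \prod_i M y i (s i)).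
    by apply/funext => y; rewrite fct_sumE.
  rewrite exchange_big /=.
  (* Induction on a list of permutations, carrying derivability along because the sum rule needs it
     at each step. *)
  have : forall r : seq 'S_n,
    derivable (\sum_(s <- r) (fun y => (-1) ^+ s * \prod_i M y i (s i))) x v /\
    'D_v (\sum_(s <- r) (fun y => (-1) ^+ s * \prod_i M y i (s i))) x =
    \sum_(s <- r) \sum_k (-1) ^+ s * \prod_i N k i (s i).
    elim=> [|s r [dr IH]].
      by rewrite !big_nil; split; [exact: derivable_cst | exact: derive_cst].
    have dp : derivable (fun y => \prod_i M y i (s i)) x v.
      by apply: diff_derivable; exact: differentiable_fprod.
    have dt : derivable (fun y => (-1) ^+ s * \prod_i M y i (s i)) x v.
      exact: (derivableM (derivable_cst ((-1) ^+ s : R) x v) dp).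
    rewrite !big_cons; split; first exact: (derivableD dt dr).
    rewrite (deriveD dt dr) IH; congr (_ + _).
    rewrite (deriveM (derivable_cst ((-1) ^+ s : R) x v) dp) derive_cst scaler0 addr0.
    rewrite derive_fprod // /GRing.scale /= mulr_sumr; apply: eq_bigr => k _.
    congr (_ * _); rewrite [RHS](bigD1 k) //= mxE eqxx; congr (_ * _).
    by apply: eq_bigr => i /negbTE ik; rewrite mxE ik.
  by move=> /(_ (index_enum 'S_n)) [].
apply: eq_bigr => k _; rewrite (expand_det_row _ k); apply: eq_bigr => j _.
rewrite mxE eqxx; congr (_ * _); rewrite /cofactor; congr (_ * \det _).
by apply/matrixP => a b; rewrite !mxE eq_sym (negbTE (neq_lift _ _)).
Qed.

(** * Symmetry of second partial derivatives *)

Lemma second_difference_MVT (R : realType) (d : nat) (f : 'rV[R]_d -> R)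
    (x : 'rV[R]_d) (i j : 'I_d) (h : R) : C2 f -> 0 < h ->
  let u := delta_mx 0 i : 'rV[R]_d in let v := delta_mx 0 j : 'rV[R]_d in
  exists s r : R, [/\ 0 < s < h, 0 < r < h &
    f (h *: u + (h *: v + x)) - f (h *: u + x) - (f (h *: v + x) - f x) =
    partial j (partial i f) (r *: v + (s *: u + x)) * h * h].
Proof.
move=> [[df _] C1f] h0 u v.
(* The second difference is the increment of [phi] over [0, h]. The mean value theorem for [phi]
   yields [s]; applied then to [partial i f] in direction [v], it yields [r]. *)
pose phi s := f (s *: u + (h *: v + x)) - f (s *: u + x).
have dphi (s : R) : is_derive s 1 phi
    (partial i f (s *: u + (h *: v + x)) - partial i f (s *: u + x)).
  by apply: is_deriveB; exact: is_derive_line.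
have cphi (psi dpsi : R -> R) : (forall s : R, is_derive s 1 psi (dpsi s)) ->
    {within `[0, h], continuous psi}.
  by move=> dpsi'; apply: derivable_within_continuous => s _.
have [s s0h phiE] := MVT h0 (fun s _ => dphi s) (cphi _ _ dphi).
have [dif _] := C1f i.
have dpsi (r : R) := is_derive_line (dif (r *: v + (s *: u + x))).
have [r r0h psiE] := MVT h0 (fun r _ => dpsi r) (cphi _ _ dpsi).
exists s, r; move: s0h r0h; rewrite !in_itv /= => -> ->; split => //.
move: phiE; rewrite /phi !scale0r !add0r subr0 => ->; congr (_ * _).
move: psiE; rewrite scale0r add0r subr0 => <-.
by rewrite [s *: u + (h *: v + x)]addrCA.
Qed.

(** Schwarz's theorem. The second difference is symmetric in [i] and [j], so the two mixed partials
    agree at two points close to [x]; continuity of both bounds their gap at [x] by any [e]. *)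
Lemma partialC (R : realType) (d : nat) (f : 'rV[R]_d -> R) (i j : 'I_d)
    (x : 'rV[R]_d) : C2 f -> partial i (partial j f) x = partial j (partial i f) x.
Proof.
move=> C2f; have [_ C1f] := C2f.
set u : 'rV[R]_d := delta_mx 0 i; set v : 'rV[R]_d := delta_mx 0 j.
apply/eqP; rewrite -subr_eq0 -normr_le0; apply/ler_addgt0Pr => e e0.
rewrite add0r; have e20 : 0 < e / 2 by rewrite divr_gt0.
have [_ /(_ i x)/cvgrPdist_le/(_ _ e20)/nbhs_ballP[r r0 fr]] := C1f j.
have [_ /(_ j x)/cvgrPdist_le/(_ _ e20)/nbhs_ballP[r' r0' fr']] := C1f i.
(* With h K = min(r, r'), every displacement s w + t w' with s, t < h along the two directions stays
   within both radii. The summand 1 keeps [K] positive and the bound strict. *)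
pose K := `|u| + `|v| + 1.
have K0 : 0 < K by rewrite ltr_wpDl ?addr_ge0.
pose h := Num.min r r' / K.
have m0 : 0 < Num.min r r' by rewrite lt_min; apply/andP; split.
have h0 : 0 < h by rewrite divr_gt0.
have near_x (w w' : 'rV[R]_d) (s t : R) : `|w| + `|w'| + 1 = K ->
    0 < s < h -> 0 < t < h -> `|x - (t *: w' + (s *: w + x))| < Num.min r r'.
  move=> KE /andP[s0 sh] /andP[t0 th].
  rewrite -[ltRHS](divfK (lt0r_neq0 K0)) -/h distrC !addrA addrK.
  apply: (le_lt_trans (ler_normD _ _)); rewrite !normrZ !gtr0_norm //.
  have sw : s * `|w| <= h * `|w| by rewrite ler_wpM2r // ltW.
  have tw : t * `|w'| <= h * `|w'| by rewrite ler_wpM2r // ltW.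
  rewrite -KE 2!mulrDr mulr1 addrC -addrA ler_ltD // ltr_pwDr //.
have [s [t [s0h t0h E1]]] := second_difference_MVT x i j C2f h0.
have [s' [t' [s0h' t0h' E2]]] := second_difference_MVT x j i C2f h0.
rewrite -/u -/v in E1 E2.
(* Exchanging the directions only permutes the four values of [f], so both mean value expressions
   agree and the common factor h * h cancels. *)
have {E1 E2} E : partial j (partial i f) (t *: v + (s *: u + x)) =
    partial i (partial j f) (t' *: u + (s' *: v + x)).
  have shuffle (a b c c' : R) : a - b - (c - c') = a - c - (b - c').
    by rewrite !opprB addrACA [RHS]addrACA [- b + _]addrC.
  rewrite addrCA shuffle E1 in E2; move: E2; move: (partial _ _ _) (partial _ _ _).
  by move=> p q /(mulIf (lt0r_neq0 h0)) /(mulIf (lt0r_neq0 h0)).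
have le1 : `|partial i (partial j f) x -
    partial i (partial j f) (t' *: u + (s' *: v + x))| <= e / 2.
  apply: fr; rewrite -ball_normE /=; apply: lt_le_trans (near_x v u s' t' _ s0h' t0h') _.
    by rewrite /K [`|v| + _]addrC.
  by rewrite ge_min lexx.
have le2 : `|partial j (partial i f) x -
    partial j (partial i f) (t *: v + (s *: u + x))| <= e / 2.
  apply: fr'; rewrite -ball_normE /=; apply: lt_le_trans (near_x u v s t erefl s0h t0h) _.
  by rewrite ge_min lexx orbT.
rewrite E distrC in le2; rewrite [e]splitr.
exact: le_trans (ler_distD _ _ _) (lerD le1 le2).
Qed.

(** * Jacobian matrices under composition *)

Lemma DH_comp (R : realType) (d : nat) (G H : 'rV[R]_d -> 'rV[R]_d) (y : 'rV[R]_d) :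
  differentiable H y -> differentiable G (H y) ->
  DH (G \o H) y = DH G (H y) *m DH H y.
Proof.
move=> dH dG; have dGH := differentiable_comp dH dG.
apply/matrixP => a c; rewrite (DHE _ _ dGH) mxE.
have -> : (fun z => (G \o H) z 0 a) = (fun x => G x 0 a) \o H by [].
rewrite /partial derive_comp_partial //; last exact: (differentiable_mxP _ _).1.
by apply: eq_bigr => b _; rewrite mulrC; congr (_ * _); apply/esym/DHE.
Qed.

Lemma DH_id (R : realType) (d : nat) (y : 'rV[R]_d) : DH id y = 1%:M.
Proof.
have did : differentiable (@id 'rV[R]_d) y by [].
apply/matrixP => a c; rewrite (DHE _ _ did) /partial derive_coord // derive_id !mxE eqxx /=.
by rewrite eq_sym.
Qed.

Lemma differentiable_ln (R : realType) (x : R) : 0 < x -> differentiable (@ln R) x.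
Proof. by move=> x0; apply/derivable1_diffP; have [] := is_derive1_ln x0. Qed.

(** * Invariance of the Stein features under conjugation *)

Section Conjugation.
Context (R : realType) (d m : nat) (V : 'rV[R]_d -> R) (B : 'rV[R]_d -> 'M[R]_(d, m)).
Context (H Hinv : 'rV[R]_d -> 'rV[R]_d).
Hypothesis dV : forall x, differentiable V x.
Hypothesis dB : forall x, differentiable B x.
Hypothesis diffeoH : C2_diffeo H Hinv.
Hypothesis orientH : orientation_preserving H.

Let HK : cancel H Hinv. Proof. by case: diffeoH. Qed.
Let HinvK : cancel Hinv H. Proof. by case: diffeoH. Qed.

Lemma diffeo_differentiable y : differentiable H y.
Proof.
apply/differentiable_mxP => i a; rewrite (ord1 i).
by case: diffeoH => _ _ /(_ a)[[+ _] _] _; exact.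
Qed.

Lemma diffeo_inv_differentiable x : differentiable Hinv x.
Proof.
apply/differentiable_mxP => i a; rewrite (ord1 i).
by case: diffeoH => _ _ _ /(_ a)[[+ _] _]; exact.
Qed.

Let dH := diffeo_differentiable.
Let dHinv := diffeo_inv_differentiable.

Lemma DH_inv_mul y : DH Hinv (H y) *m DH H y = 1%:M.
Proof.
rewrite -DH_comp // -[RHS](DH_id y); congr (DH _ y).
by apply/funext => z /=; rewrite HK.
Qed.

(** Cramer's rule: the adjugate is the determinant times the inverse, and the inverse of [DH H y] is
    [DH Hinv (H y)]. *)
Lemma cofactor_DH y a c :
  cofactor (DH H y) a c = \det (DH H y) * DH Hinv (H y) c a.
Proof.
have JK := mulmx1C (DH_inv_mul y).
have -> : cofactor (DH H y) a c = (\adj (DH H y)) c a by rewrite mxE.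
by rewrite -[\adj _]mulmx1 -JK mulmxA mul_adj_mx mul_scalar_mx mxE.
Qed.

Let DH_entryE a c : (fun z => DH H z a c) = partial c (fun z => H z 0 a).
Proof. by apply/funext => z; exact: DHE. Qed.

Lemma DH_differentiable y : differentiable (DH H) y.
Proof.
apply/differentiable_mxP => a c.
rewrite DH_entryE.
by case: diffeoH => _ _ /(_ a)[_ /(_ c)[+ _]] _; exact.
Qed.

(** Both sides are mixed second partials of the coordinate [a] of [H]. *)
Lemma partial_DH a c e y :
  partial e (fun z => DH H z a c) y = partial c (fun z => DH H z a e) y.
Proof.
by rewrite !DH_entryE; apply: partialC; case: diffeoH.
Qed.

Lemma partial_comp_inv (g : 'rV[R]_d -> R) a y : differentiable g y ->
  partial a (g \o Hinv) (H y) = \sum_e DH Hinv (H y) e a * partial e g y.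
Proof.
move=> dg; rewrite /partial derive_comp_partial ?HK //.
by apply: eq_bigr => e _; rewrite (DHE _ _ (dHinv _)).
Qed.

(** The transformed potential read in base coordinates: [conj_potential V H Hinv] is [W] composed
    with [Hinv]. *)
Let W y := V y + ln (\det (DH H y)).

Lemma base_potential_differentiable y : differentiable W y.
Proof.
apply: differentiableD => //.
apply: (@differentiable_comp _ _ _ _ (fun z => \det (DH H z)) (@ln R)).
  by apply: differentiable_det; exact: DH_differentiable.
exact: differentiable_ln.
Qed.

(** Jacobi's formula: the derivative of log det J is the trace of the inverse of J times the
    derivative of J. The determinant in [cofactor_DH] cancels the one from the derivative of
    [ln]. *)
Lemma partial_base_potential e y :
  partial e W y = partial e V y +
    \sum_a \sum_c DH Hinv (H y) c a * partial e (fun z => DH H z a c) y.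
Proof.
have ddet : differentiable (fun z => \det (DH H z)) y.
  by apply: differentiable_det; exact: DH_differentiable.
have dln : differentiable (@ln R) (\det (DH H y)).
  exact: differentiable_ln.
rewrite /partial (deriveD (f := V) (g := @ln R \o (fun z => \det (DH H z)))).
- congr (_ + _); rewrite deriveE; last exact: differentiable_comp.
  rewrite diff_comp //= -(deriveE _ ddet) derive_det; last exact: DH_differentiable.
  rewrite diff1E // derive1E (@derive_val _ _ _ _ _ _ _ (is_derive1_ln (orientH y))).
  rewrite /GRing.scale /= mulr_suml; apply: eq_bigr => a _.
  rewrite mulr_suml; apply: eq_bigr => c _.
  rewrite cofactor_DH [\det _ * _]mulrC mulrA mulfK; last exact: lt0r_neq0.
  exact: mulrC.
- exact: diff_derivable.
- by apply: diff_derivable; exact: differentiable_comp.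
Qed.


Lemma conj_factor_differentiable x : differentiable (conj_factor B H Hinv) x.
Proof.
apply/differentiable_mxP => a j; rewrite /conj_factor.
under eq_fun do rewrite mxE.
apply: differentiable_fsum => c; apply: differentiableM.
  apply: (@differentiable_comp _ _ _ _ Hinv (fun z => DH H z a c)) => //.
  exact: ((differentiable_mxP _ _).1 (DH_differentiable _)).
apply: (@differentiable_comp _ _ _ _ Hinv (fun z => B z c j)) => //.
exact: ((differentiable_mxP _ _).1 (dB _)).
Qed.

(* Piola's identity: the terms containing second derivatives of H are the same
   in div b_j and in b_j . grad V_H, so they cancel. *)
Lemma stein_feature_conj y :
  stein_feature (conj_potential V H Hinv) (conj_factor B H Hinv) (H y) =
  stein_feature V B y.
Proof.
have dBc c j : differentiable (fun z => B z c j) y.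
  exact: ((differentiable_mxP _ _).1 (dB _)).
have dDH a c : differentiable (fun z => DH H z a c) y.
  exact: ((differentiable_mxP _ _).1 (DH_differentiable _)).
set J := DH H y; set K := DH Hinv (H y).
have KJ : K *m J = 1%:M by exact: DH_inv_mul.
apply/rowP => j; rewrite !mxE.
pose h a c e := partial e (fun z => DH H z a c) y.
pose b c := B y c j; pose db c e := partial e (fun z => B z c j) y.
have div_conj a : partial a (fun x => conj_factor B H Hinv x a j) (H y) =
    \sum_e K e a * \sum_c (J a c * db c e + b c * h a c e).
  have -> : (fun x => conj_factor B H Hinv x a j) =
      (fun z => \sum_c DH H z a c * B z c j) \o Hinv.
    by apply/funext => x; rewrite mxE.
  have dprod c : differentiable (fun z => DH H z a c * B z c j) y.
    exact: differentiableM.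
  rewrite partial_comp_inv; last exact: differentiable_fsum.
  apply: eq_bigr => e _; congr (_ * _); rewrite /partial derive_fsum; last first.
    by move=> c; exact: diff_derivable.
  by apply: eq_bigr => c _; rewrite deriveM //; exact: diff_derivable.
have pot_conj a : partial a (conj_potential V H Hinv) (H y) =
    \sum_e K e a * partial e W y.
  exact: partial_comp_inv (base_potential_differentiable y).
under eq_bigr do rewrite div_conj.
under [X in _ - X]eq_bigr do rewrite pot_conj mxE HK.
have sum_KJ e c : \sum_a K e a * J a c = (e == c)%:R.
  by move/matrixP/(_ e c): KJ; rewrite !mxE.
(* Contracting with K J = 1 turns the terms in [db] into div b_j and those in [W] into b_j . grad W.
   Only the second derivatives [h] of [H] remain uncontracted. *)
transitivity (\sum_e db e e + \sum_c b c * (\sum_a \sum_e K e a * h a c e)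
  - \sum_c b c * partial c W y).
  congr (_ - _).
    transitivity (\sum_a \sum_e \sum_c (K e a * J a c * db c e + b c * (K e a * h a c e))).
      apply: eq_bigr => a _; apply: eq_bigr => e _; rewrite mulr_sumr.
      by apply: eq_bigr => c _; rewrite mulrDr mulrA [K e a * (b c * _)]mulrCA.
    under eq_bigr do under eq_bigr do rewrite big_split /=.
    under eq_bigr do rewrite big_split /=.
    rewrite big_split /=; congr (_ + _).
      rewrite exchange_big; apply: eq_bigr => e _; rewrite exchange_big /=.
      under eq_bigr do rewrite -mulr_suml sum_KJ.
      rewrite (bigD1 e) //= eqxx mul1r big1 ?addr0 // => c /negbTE ce.
      by rewrite eq_sym ce mul0r.
    under eq_bigr do rewrite exchange_big /=.
    rewrite exchange_big /=; apply: eq_bigr => c _.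
    by rewrite mulr_sumr; apply: eq_bigr => a _; rewrite mulr_sumr.
  transitivity (\sum_a \sum_c \sum_e (K e a * J a c) * (b c * partial e W y)).
    apply: eq_bigr => a _; rewrite mulr_suml; apply: eq_bigr => c _.
    rewrite mulr_sumr; apply: eq_bigr => e _.
    by rewrite mulrACA [J a c * K e a]mulrC mulrACA mulrA.
  rewrite exchange_big /=; apply: eq_bigr => c _; rewrite exchange_big /=.
  under eq_bigr do rewrite -mulr_suml sum_KJ.
  rewrite (bigD1 c) //= eqxx mul1r big1 ?addr0 // => e /negbTE ce.
  by rewrite ce mul0r.
(* Compare the coefficients of each [b c]: the log-determinant part of [partial c W] matches the sum
   over [h] once [partial_DH] exchanges the indices. *)
rewrite -addrA; congr (_ + _); rewrite -sumrB -sumrN; apply: eq_bigr => c _.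
rewrite -mulrBr -mulrN; congr (_ * _); rewrite partial_base_potential opprD addrCA.
rewrite [X in _ + (X - _)](_ : _ = \sum_a \sum_e K e a * partial c (fun z => DH H z a e) y).
  by rewrite subrr addr0.
by apply: eq_bigr => a _; apply: eq_bigr => e _; congr (_ * _); exact: partial_DH.
Qed.

End Conjugation.

(** * Integrals under image measures, and linear combinations *)

(* No integrability is required: the positive and negative parts are transferred
   separately, so both sides have the same value even when it is the junk value
   of a difference of infinities. *)
Lemma integral_push d1 d2 (X : measurableType d1) (Y : measurableType d2)
    (R : realType) (phi : X -> Y) (mu : {measure set X -> \bar R})
    (nu : {measure set Y -> \bar R}) (f : Y -> \bar R) :
  measurable_fun setT phi ->
  (forall A, measurable A -> nu A = mu (phi @^-1` A)) ->
  measurable_fun setT f ->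
  (\int[nu]_y f y = \int[mu]_x f (phi x))%E.
Proof.
move=> mphi nuE mf.
have ge0 (g : Y -> \bar R) : measurable_fun setT g -> (forall y, 0 <= g y)%E ->
    (\int[nu]_y g y = \int[mu]_x (g \o phi) x)%E.
  move=> mg g0; rewrite -[RHS](@ge0_integral_pushforward _ _ _ _ _ _ mphi mu setT)//.
  by apply: eq_measure_integral => A mA _; exact: nuE.
rewrite integralE [RHS]integralE !ge0 //; [|exact: measurable_funeneg|exact: measurable_funepos].
by rewrite -funepos_comp -funeneg_comp.
Qed.

Lemma Rintegral_push d1 d2 (X : measurableType d1) (Y : measurableType d2)
    (R : realType) (phi : X -> Y) (mu : {measure set X -> \bar R})
    (nu : {measure set Y -> \bar R}) (f : Y -> R) :
  measurable_fun setT phi ->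
  (forall A, measurable A -> nu A = mu (phi @^-1` A)) ->
  measurable_fun setT f ->
  \int[nu]_y f y = \int[mu]_x f (phi x).
Proof.
move=> mphi nuE mf; congr fine; apply: (integral_push mphi nuE).
exact/measurable_EFinP.
Qed.

Lemma integrable_push d1 d2 (X : measurableType d1) (Y : measurableType d2)
    (R : realType) (phi : X -> Y) (mu : {measure set X -> \bar R})
    (nu : {measure set Y -> \bar R}) (f : Y -> \bar R) :
  measurable_fun setT phi ->
  (forall A, measurable A -> nu A = mu (phi @^-1` A)) ->
  measurable_fun setT f -> mu.-integrable setT (f \o phi) ->
  nu.-integrable setT f.
Proof.
move=> mphi nuE mf /integrableP[_ fi]; apply/integrableP; split => //.
by rewrite (integral_push mphi nuE) //; exact: measurableT_comp.
Qed.

Lemma Rintegral_lincomb d1 (X : measurableType d1) (R : realType)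
    (mu : {measure set X -> \bar R}) (n : nat) (c : 'I_n -> R) (f : 'I_n -> X -> R) :
  (forall j, mu.-integrable setT (EFin \o f j)) ->
  \int[mu]_x (\sum_j c j * f j x) = \sum_j c j * \int[mu]_x f j x.
Proof.
move=> fi; rewrite /Rintegral.
under eq_integral do rewrite -sumEFin.
rewrite integral_sum //; last first.
  move=> j; have := integrableZl measurableT (c j) (fi j).
  by apply: eq_integrable => // x _ /=; rewrite EFinM.
have E j : (\int[mu]_x (c j * f j x)%:E = (c j * fine (\int[mu]_x (f j x)%:E))%:E)%E.
  under eq_integral do rewrite EFinM.
  by rewrite (integralZl measurableT (fi j)) EFinM fineK //; exact: integrable_fin_num (fi j).
by under eq_bigr do rewrite E; rewrite sumEFin.
Qed.

(** * Borel measurability, empirical measures, velocities and test functions *)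

Section Borel.
Context (R : realType) (d : nat).

Lemma continuous_borel_measurable (f : 'rV[R]_d -> R) :
  continuous f -> measurable_fun setT (f : borel_rV R d -> R).
Proof.
move=> /continuousP cf; apply: (measurability _ (RGenOpens.measurableE R)).
move=> _ [_ [a [b ->] <-]]; rewrite setTI.
by apply: sub_sigma_algebra; exact/cf/interval_open.
Qed.

Lemma continuous_borel_rV_measurable (g : 'rV[R]_d -> 'rV[R]_d) :
  continuous g -> measurable_fun setT (g : borel_rV R d -> borel_rV R d).
Proof.
move=> /continuousP cg.
apply: (@measurability _ _ (borel_rV R d) (borel_rV R d) setT g (@open 'rV[R]_d)) => //.
by move=> _ [A oA <-]; rewrite setTI; apply: sub_sigma_algebra; exact: cg.
Qed.

(** An empirical measure is a finite combination of Dirac masses, so the integral of |f| is a finite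
    sum of finite values. *)
Lemma integrable_empirical (N : nat) (X : 'I_N -> 'rV[R]_d) (f : borel_rV R d -> R) :
  measurable_fun setT f -> (empirical X).-integrable setT (EFin \o f).
Proof.
move=> mf; apply/integrableP; split; first exact/measurable_EFinP.
(* Dirac masses continued by the zero measure beyond [N], because [msum] takes a sequence indexed by
   all naturals. *)
pose m (k : nat) : {measure set (borel_rV R d) -> \bar R} :=
  if insub k is Some i then \d_(X i : borel_rV R d) else mzero.
have N0 : 0 <= N%:R^-1 :> R by rewrite invr_ge0.
pose mu : {measure set (borel_rV R d) -> \bar R} :=
  mscale (NngNum N0) (msum m N).
have mg : measurable_fun setT (fun x => `|(EFin \o f) x|%E).
  by apply: measurableT_comp => //; exact/measurable_EFinP.
have -> : (\int[empirical X]_x `|(EFin \o f) x| =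
    \int[mu]_x `|(EFin \o f) x|)%E.
  apply: eq_measure_integral => A mA _; rewrite /mu /empirical /mscale /msum /=.
  by congr (_ * _)%E; apply: eq_bigr => i _; rewrite /m valK.
rewrite /mu ge0_integral_mscale // ge0_integral_measure_sum //.
rewrite lte_mul_pinfty // ?lee_fin //.
apply/lte_sum_pinfty => i _; rewrite /m valK integral_dirac //.
by rewrite diracE mem_setT mul1e ltry.
Qed.

End Borel.

(** Finite rank makes the integrand a combination of the features at [y] with coefficients
    [B x a j], since div_y differentiates only the second factor of the kernel. Integrability lets
    the sum leave the integral. *)
Lemma velocityE (R : realType) (d m : nat) (V : 'rV[R]_d -> R)
    (B : 'rV[R]_d -> 'M[R]_(d, m)) (rho : {measure set (borel_rV R d) -> \bar R}) x :
  (forall y, differentiable B y) ->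
  (forall j, rho.-integrable setT (fun y => (stein_feature V B y 0 j)%:E)) ->
  velocity V B rho x = feature_mean V B rho *m (B x)^T.
Proof.
move=> dB fi; apply/rowP => a; rewrite !mxE.
transitivity (\int[rho]_y (\sum_j B x a j * stein_feature V B y 0 j)).
  apply: eq_Rintegral => y _.
  have dBc c j : differentiable (fun z => B z c j) y.
    exact: ((differentiable_mxP _ _).1 (dB _)).
  have kernelE z b : Defs.kernel B x z a b = \sum_j B x a j * B z b j.
    by rewrite mxE; apply: eq_bigr => j _; rewrite mxE.
  have partial_kernel b : partial b (fun z => Defs.kernel B x z a b) y =
      \sum_j B x a j * partial b (fun z => B z b j) y.
    under eq_fun do rewrite kernelE.
    rewrite /partial derive_fsum; last first.
      by move=> j; apply: derivableM; [exact: derivable_cst|exact: diff_derivable].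
    apply: eq_bigr => j _; rewrite deriveM; last exact: diff_derivable.
      by rewrite derive_cst scaler0 addr0.
    exact: derivable_cst.
  under [X in _ + X]eq_bigr do rewrite partial_kernel.
  under [X in - X]eq_bigr do rewrite kernelE mulr_suml.
  rewrite exchange_big [X in _ + X]exchange_big /= addrC -sumrB.
  apply: eq_bigr => j _; rewrite mxE mulrBr !mulr_sumr; congr (_ - _).
  by apply: eq_bigr => b _; rewrite mulrA.
rewrite Rintegral_lincomb //; apply: eq_bigr => j _.
by rewrite !mxE mulrC.
Qed.

Lemma continuous_fsum (R : realType) (T : topologicalType) (n : nat)
    (f : 'I_n -> T -> R) :
  (forall i, continuous (f i)) -> continuous (fun x => \sum_i f i x).
Proof.
move=> cf; have -> : (fun x => \sum_i f i x) = \sum_i f i.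
  by apply/funext => x; rewrite fct_sumE.
elim/big_ind: _ => [x|g h cg ch x|i _]; [exact: cvg_cst| |exact: cf].
exact: (continuousD (cg x) (ch x)).
Qed.

(** Makes [phi \o H] a legitimate test function for the base equation: its support lies in the
    compact image of [S] under [Hinv]. *)
Lemma C1_comp_diffeo (R : realType) (d : nat) (H Hinv : 'rV[R]_d -> 'rV[R]_d)
    (phi : 'rV[R]_d -> R) : C2_diffeo H Hinv ->
  C1_compactly_supported phi -> C1_compactly_supported (phi \o H).
Proof.
move=> dfH [[dphi cphi] [S cS phi0]].
have dH := diffeo_differentiable dfH; have dHinv := diffeo_inv_differentiable dfH.
have cH : continuous H by move=> y; exact: differentiable_continuous.
have cHinv : continuous Hinv by move=> y; exact: differentiable_continuous.
split; [split|].
- by move=> y; exact: differentiable_comp.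
- move=> c.
  have -> : partial c (phi \o H) =
      (fun y => \sum_a partial c (fun z => H z 0 a) y * (partial a phi \o H) y).
    by apply/funext => y; rewrite /partial derive_comp_partial.
  apply: continuous_fsum => a y; apply: continuousM.
    by case: dfH => _ _ /(_ a)[[_ cpH] _] _; exact: cpH.
  exact: (continuous_comp (cH y) (cphi a (H y))).
- exists (Hinv @` S) => [|y Sy].
    by apply: continuous_compact => // x; exact/continuous_subspaceT/cHinv.
  apply: phi0 => SHy; apply: Sy; exists (H y) => //.
  by case: dfH => HK _ _ _; rewrite HK.
Qed.

(** * Transport of feature means, velocities and solutions *)

Section Transport.
Context (R : realType) (d m : nat) (V : 'rV[R]_d -> R) (B : 'rV[R]_d -> 'M[R]_(d, m)).
Context (H Hinv : 'rV[R]_d -> 'rV[R]_d).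
Hypothesis dV : forall x, differentiable V x.
Hypothesis dB : forall x, differentiable B x.
Hypothesis diffeoH : C2_diffeo H Hinv.
Hypothesis orientH : orientation_preserving H.
Hypothesis mF : forall j,
  measurable_fun setT ((fun x => stein_feature V B x 0 j) : borel_rV R d -> R).

Let VH := conj_potential V H Hinv.
Let BH := conj_factor B H Hinv.
Let mes := {measure set (borel_rV R d) -> \bar R}.
(** A relation on measurable sets only, so that it covers empirical measures, image measures and a
    given curve of laws alike. *)
Let pushed (mu nu : mes) := forall A, measurable A -> nu A = push H mu A.

Let HinvK : cancel Hinv H. Proof. by case: diffeoH. Qed.
Let dH := diffeo_differentiable diffeoH.
Let dHinv := diffeo_inv_differentiable diffeoH.
Let cH : continuous H. Proof. by move=> y; exact: differentiable_continuous. Qed.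
Let mH : measurable_fun setT (H : borel_rV R d -> borel_rV R d).
Proof. exact: continuous_borel_rV_measurable. Qed.

Let mFH j : measurable_fun setT
  ((fun x => stein_feature VH BH x 0 j) : borel_rV R d -> R).
Proof.
have -> : (fun x => stein_feature VH BH x 0 j) =
    (fun x => stein_feature V B x 0 j) \o Hinv.
  by apply/funext => x /=; rewrite -{1}[x]HinvK stein_feature_conj.
apply: (measurableT_comp (mF j)).
by apply: continuous_borel_rV_measurable => x; exact: differentiable_continuous.
Qed.

Lemma feature_mean_push (mu nu : mes) :
  pushed mu nu -> feature_mean VH BH nu = feature_mean V B mu.
Proof.
move=> nuE; apply/rowP => j; rewrite !mxE (Rintegral_push mH nuE (mFH j)).
by apply: eq_Rintegral => y _; rewrite stein_feature_conj.
Qed.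

Lemma feature_integrable_push (mu nu : mes) j : pushed mu nu ->
  mu.-integrable setT (fun x => (stein_feature V B x 0 j)%:E) ->
  nu.-integrable setT (fun x => (stein_feature VH BH x 0 j)%:E).
Proof.
move=> nuE iF; apply: (integrable_push mH nuE).
  by apply/measurable_EFinP; exact: mFH.
by apply: eq_integrable iF => // y _ /=; rewrite stein_feature_conj.
Qed.

(** In the form B(x) rho F the feature means agree, and the factor of the conjugate pair at [H y] is
    [DH H y *m B y]. *)
Lemma velocity_push (mu nu : mes) y : pushed mu nu ->
  (forall j, mu.-integrable setT (fun x => (stein_feature V B x 0 j)%:E)) ->
  velocity VH BH nu (H y) = velocity V B mu y *m (DH H y)^T.
Proof.
move=> nuE iF; rewrite !velocityE //; last 2 first.
- by move=> x; exact: conj_factor_differentiable.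
- by move=> j; exact: (feature_integrable_push nuE (iF j)).
rewrite (feature_mean_push nuE) /BH /conj_factor trmx_mul mulmxA.
by case: diffeoH => HK _ _ _; rewrite HK.
Qed.

Lemma empirical_push (N : nat) (X : 'I_N -> 'rV[R]_d) :
  pushed (empirical X) (empirical (fun i => H (X i))).
Proof. by move=> A mA; rewrite /push /pushforward /= /empirical. Qed.

Lemma particle_solution_push (N : nat) (x0 : 'I_N -> 'rV[R]_d)
    (X : R -> 'I_N -> 'rV[R]_d) :
  particle_solution V B x0 X ->
  particle_solution VH BH (fun i => H (x0 i)) (fun t i => H (X t i)).
Proof.
move=> [X0 cX dX]; split.
- by move=> i; rewrite X0.
- by move=> i t; apply: continuous_comp; [exact: cX|exact: cH].
- move=> t i t0; have [dXi XiE] := dX t i t0.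
  have dXt : differentiable (fun s => X s i) t by exact/derivable1_diffP.
  (* Measurability of the features suffices here, by [integrable_empirical]. *)
  rewrite (velocity_push _ (empirical_push (X t))); last first.
    by move=> j; exact: integrable_empirical.
  apply: DeriveDef; first exact/derivable1_diffP/differentiable_comp.
  rewrite deriveE; last exact: differentiable_comp.
  rewrite diff_comp //= -(deriveE _ dXt) XiE -deriveE // deriveEjacobian //.
  by rewrite /DH trmxK.
Qed.

(** The transformed weak equation tested on [phi] is the base one tested on [phi \o H]: by the chain
    rule, pairing grad phi at [H x] with DH v equals pairing grad (phi o H) at [x] with v. *)
Lemma mean_field_solution_push (mu0 : set (borel_rV R d) -> \bar R)
    (mu muH : R -> probability (borel_rV R d) R) :
  (forall t, pushed (mu t) (muH t)) ->
  mean_field_solution V B mu0 mu ->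
  mean_field_solution VH BH (push H mu0) muH.
Proof.
move=> muHE [mu00 iF weak]; split.
- move=> A mA; rewrite muHE //; apply: mu00.
  by rewrite -[X in measurable X]setTI; exact: mH.
- by move=> t j t0; apply: (feature_integrable_push (muHE t)); exact: iF.
move=> phi C1phi rate t t0.
have [[dphi cphi] _] := C1phi.
have mass s : \int[muH s]_x phi x = \int[mu s]_x phi (H x).
  apply: (Rintegral_push mH (muHE s)); apply: continuous_borel_measurable => x.
  exact: differentiable_continuous.
have rateE s : 0 <= s -> rate s = \int[mu s]_x
    (\sum_a partial a (phi \o H) x * velocity V B (mu s) x 0 a).
  move=> s0; have iFs j := iF s j s0.
  rewrite /rate (Rintegral_push mH (muHE s)); last first.
    apply: continuous_borel_measurable; apply: continuous_fsum => a.
    (* In feature form the velocity has constant coefficients against the entries of [BH], hence the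
       integrand is continuous and so measurable. *)
    have -> : (fun x => partial a phi x * velocity VH BH (muH s) x 0 a) =
        partial a phi \* (fun x => \sum_j feature_mean V B (mu s) 0 j * BH x a j).
      apply/funext => x; rewrite velocityE.
      - rewrite (feature_mean_push (muHE s)) mxE /=; congr (_ * _).
        by apply: eq_bigr => j _; rewrite [_^T _ _]mxE.
      - by move=> y; exact: conj_factor_differentiable.
      - by move=> j; exact: (feature_integrable_push (muHE s) (iFs j)).
    move=> x; apply: continuousM; first exact: cphi.
    apply: differentiable_continuous; apply: differentiable_fsum => j.
    apply: differentiableM => //.
    exact: ((differentiable_mxP _ _).1 (conj_factor_differentiable dB diffeoH x)).
  apply: eq_Rintegral => x _; rewrite (velocity_push _ (muHE s)) //.
  transitivity (\sum_a \sum_c partial a phi (H x) * (velocity V B (mu s) x 0 c * DH H x a c)).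
    apply: eq_bigr => a _; rewrite mxE mulr_sumr.
    by apply: eq_bigr => c _; rewrite [_^T _ _]mxE.
  rewrite exchange_big; apply: eq_bigr => c _ /=.
  rewrite [partial c _ x](derive_comp_partial _ (dH x) (dphi (H x))) mulr_suml.
  by apply: eq_bigr => a _; rewrite (DHE _ _ (dH x)) mulrCA mulrC [X in X * _]mulrC.
have [ri wE] := weak _ (C1_comp_diffeo diffeoH C1phi) t t0.
have in0t s : s \in `[0, t]%classic -> 0 <= s.
  by rewrite inE /= in_itv /= => /andP[].
split.
  by apply: eq_integrable ri => // s /in0t s0; rewrite rateE.
rewrite [LHS](mass t).
rewrite [LHS]wE.
apply: (congr2 +%R (esym (mass 0))).
apply: eq_Rintegral => s /in0t s0.
exact: (esym (rateE s s0)).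
Qed.

End Transport.

Theorem corollary5p5 (R : realType) (d m : nat)
    (* finite-rank base pair *)
    (V : 'rV[R]_d -> R) (B : 'rV[R]_d -> 'M[R]_(d, m))
    (piV : probability (borel_rV R d) R)
    (dV : forall x, differentiable V x)
    (dB : forall x, differentiable B x)
    (gibbsV : gibbs V piV)
    (* conjugate pair *)
    (H Hinv : 'rV[R]_d -> 'rV[R]_d)
    (diffeoH : C2_diffeo H Hinv) (orientH : orientation_preserving H)
    (piH : probability (borel_rV R d) R)
    (piHE : forall A, measurable A -> piH A = push H piV A)
    (* initial law and mean-field solutions *)
    (mu0 : probability (borel_rV R d) R)
    (mu muH : R -> probability (borel_rV R d) R)
    (* random initial data and particle systems, for every number of particles *)
    (dO : measure_display) (Om : measurableType dO) (P : probability Om R)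
    (X0 : forall N : nat, 'I_N -> Om -> borel_rV R d)
    (X XH : forall N : nat, Om -> R -> 'I_N -> 'rV[R]_d) :
  let VH := conj_potential V H Hinv in
  let BH := conj_factor B H Hinv in
  let mu0H := push H mu0 in
  (* standing assumption: global well-posedness *)
  mean_field_well_posed V B mu0 ->
  mean_field_well_posed VH BH mu0H ->
  (forall N w, (0 < N)%N -> particle_well_posed V B (fun i => X0 N i w)) ->
  (forall N w, (0 < N)%N -> particle_well_posed VH BH (fun i => H (X0 N i w))) ->
  mean_field_solution V B mu0 mu ->
  mean_field_solution VH BH mu0H muH ->
  (forall N, (0 < N)%N -> iid P mu0 (X0 N)) ->
  (forall N w, (0 < N)%N ->
     particle_solution V B (fun i => X0 N i w) (X N w)) ->
  (forall N w, (0 < N)%N ->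
     particle_solution VH BH (fun i => H (X0 N i w)) (XH N w)) ->
  let err N t w := feature_dist V B (empirical (X N w t)) (mu t) in
  let errH N t w := feature_dist VH BH (empirical (XH N w t)) (muH t) in
  [/\ (forall N w t, (0 < N)%N -> 0 <= t -> errH N t w = err N t w),
      (* any propagation-of-chaos estimate, expressed by an arbitrary functional
         of the random error process (t, w) |-> err N t w, t >= 0 *)
      (forall (Est : nat -> ({nonneg R} -> Om -> R) -> \bar R)
              (C : R) (eps : nat -> R),
         (forall N, (0 < N)%N ->
            (Est N (fun t w => err N t%:num w) <= (C * eps N)%:E)%E) ->
         (forall N, (0 < N)%N ->
            (Est N (fun t w => errH N t%:num w) <= (C * eps N)%:E)%E)) &
      (forall (C : R) (eps : nat -> R),
         eps @ \oo --> (0 : R) ->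
         (forall N, (0 < N)%N ->
            (\int[P]_w ereal_sup [set (err N t w ^+ 2)%:E | t in `[0%R, +oo[]
              <= (C * eps N)%:E)%E) ->
         (forall N, (0 < N)%N ->
            (\int[P]_w ereal_sup [set (errH N t w ^+ 2)%:E | t in `[0%R, +oo[]
              <= (C * eps N)%:E)%E))].
Proof.
move=> VH BH mu0H wp wpH pwp pwpH sol solH iid0 psol psolH err errH.
have dH := diffeo_differentiable diffeoH.
have mH : measurable_fun setT (H : borel_rV R d -> borel_rV R d).
  by apply: continuous_borel_rV_measurable => y; exact: differentiable_continuous.
(* Measurability of the features is read off from their integrability at time 0 under the base
   solution. *)
have mF j : measurable_fun setT
    ((fun x => stein_feature V B x 0 j) : borel_rV R d -> R).
  have [_ iF _] := sol.
  by have /integrableP[/measurable_EFinP] := iF 0 j (lexx 0).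
pose Hm : {mfun borel_rV R d >-> borel_rV R d} :=
  HB.pack (H : borel_rV R d -> borel_rV R d) (isMeasurableFun.Build _ _ _ _ _ mH).
(* The image of the base curve under [H], packaged as probabilities so that it can compete with
   [muH] in the uniqueness statement. *)
pose nu t : probability (borel_rV R d) R := distribution (mu t) Hm.
have nu_sol : mean_field_solution VH BH mu0H nu.
  by apply: (mean_field_solution_push dV dB diffeoH orientH mF) sol.
have muH_push t A : 0 <= t -> measurable A -> muH t A = push H (mu t) A.
  by move=> t0 mA; rewrite (wpH.2 _ _ solH nu_sol t t0 A mA).
have particle_push N w t : (0 < N)%N -> 0 <= t ->
    XH N w t = fun i => H (X N w t i).
  move=> N0 t0; apply/funext => i.
  have pushed := particle_solution_push dV dB diffeoH orientH mF (psol N w N0).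
  exact: (pwpH N w N0).2 (psolH N w N0) pushed t t0 i.
have errE N w t : (0 < N)%N -> 0 <= t -> errH N t w = err N t w.
  move=> N0 t0; rewrite /errH /err /feature_dist (particle_push N w t N0 t0).
  have -> := feature_mean_push dV dB diffeoH orientH mF (empirical_push H (X N w t)).
  by have -> := feature_mean_push dV dB diffeoH orientH mF (fun A => @muH_push t A t0).
split; [exact: errE|move=> Est C eps bound N N0|move=> C eps _ bound N N0].
  (* Indexed by nonnegative times, the two error processes are equal as functions, so every
     functional [Est] takes the same value on both. *)
  rewrite (_ : (fun _ _ => _) = fun (t : {nonneg R}) w => err N t%:num w); first exact: bound.
  by apply/funext => t; apply/funext => w; exact: errE.
(* For each outcome the two suprema range over the same set of squared errors, so no measurability
   of the supremum is involved. *)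
have sqE w : [set (errH N t w ^+ 2)%:E | t in `[0%R, +oo[] =
    [set (err N t w ^+ 2)%:E | t in `[0%R, +oo[].
  by apply: eq_imagel => t /=; rewrite in_itv /= andbT => t0; rewrite (errE N w t N0 t0).
by under eq_integral do rewrite sqE; exact: bound.
Qed.
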